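(* Let $n\ge 1$ be an integer. Suppose that $y=(y_1,\dots,y_{2n})\in\mathbb R^{2n}$ is feasible in the semidefinite program $$\min\ \sum_{i=1}^{2n}a_iy_i\quad\text{s.t.}\quad \sum_{i=1}^{2n}y_iA_i+A_0\succeq 0,$$ that is, the $(n+1)\times(n+1)$ Hankel matrix whose $(k,\ell)$ entry is $y_{k+\ell-2}$ (with $y_0:=1$), $k,\ell\in\{1,\dots,n+1\}$, is positive semidefinite. Then $$y_{2(n-j+1)}\ \ge\ y_{2(n-j)}^{\,1+1/(n-j)}\quad\text{for } j=1,\dots,n-1,\qquad\text{and}\qquad y_{2n}\ \ge\ y_2^{\,n}.$$
   Context: For $i\in\{0,1,\dots,2n\}$, $A_i$ is the symmetric $(n+1)\times(n+1)$ matrix whose $(k,\ell)$ entry is $1$ if $k+\ell=i+2$ and $0$ otherwise. The $a_i$ are the coefficients of a univariate polynomial $f(x)=\sum_{i=0}^{2n}a_ix^i$ with $a_{2n}>0$; the SDP above is the dual of the sum-of-squares SDP ($\max -A_0\bullet Q$ s.t. $A_i\bullet Q=a_i$ for $i=1,\dots,2n$, $Q\succeq 0$) associated with minimizing $f$ over $\mathbb R$. Here $S\succeq 0$ means positive semidefinite, and $S\bullet T=\operatorname{trace}(ST)$. *)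

(* Defs.v *)
From HB Require Import structures.
From mathcomp Require Import all_boot all_order all_algebra.
From mathcomp Require Import boolp reals exp.

Set Implicit Arguments.
Unset Strict Implicit.
Unset Printing Implicit Defensive.

Import Order.TTheory GRing.Theory Num.Theory.
Local Open Scope ring_scope.

Definition psd (R : realType) (p : nat) (S : 'M[R]_p) : Prop :=
  S \is symmetricmx /\ forall v : 'cV[R]_p, 0 <= (v^T *m S *m v) 0 0.

(* The program  min \sum_i sdp_cost_i y_i  s.t.  \sum_i y_i sdp_coef_i + sdp_const
   is positive semidefinite; the variables y_1, .., y_m have indices shifted
   to 0, .., m - 1. *)
Record sdp (R : realType) (m p : nat) := SDP {
  sdp_cost : 'I_m -> R;
  sdp_coef : 'I_m -> 'M[R]_p;
  sdp_const : 'M[R]_p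
}.

Definition sdp_objective (R : realType) (m p : nat) (P : sdp R m p)
    (y : m.-tuple R) : R :=
  \sum_(i < m) sdp_cost P i * tnth y i.

Definition sdp_feasible (R : realType) (m p : nat) (P : sdp R m p)
    (y : m.-tuple R) : Prop :=
  psd (\sum_(i < m) tnth y i *: sdp_coef P i + sdp_const P).

(* Rows and columns are numbered from 0, so that the 1-based condition
   k + l = i + 2 becomes k + l = i. *)
Definition antidiag_mx (R : realType) (n i : nat) : 'M[R]_n.+1 :=
  \matrix_(k < n.+1, l < n.+1) (k + l == i)%N%:R.

(* The dual of the program  max - A_0 . Q  s.t.  A_i . Q = f_i (1 <= i <= 2n),
   Q positive semidefinite, where A_i is antidiag_mx R n i; it minimizes a
   polynomial f of degree 2n over R by sums of squares. *)
Definition dual_sos_sdp (R : realType) (n : nat) (f : {poly R}) :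
    sdp R (2 * n) n.+1 :=
  {| sdp_cost := fun i => f`_i.+1;
     sdp_coef := fun i => antidiag_mx R n i.+1;
     sdp_const := antidiag_mx R n 0 |}.

(* y_i in 1-based indexing, with y_0 = 1. *)
Definition moment (R : realType) (m : nat) (y : m.-tuple R) (i : nat) : R :=
  (1 :: y)`_i.

Lemma dual_sos_sdp_feasibleE (R : realType) (n : nat) (f : {poly R})
    (y : (2 * n).-tuple R) :
  sdp_feasible (dual_sos_sdp n f) y
  <-> psd (\matrix_(k < n.+1, l < n.+1) moment y (k + l)).
Proof.
rewrite /sdp_feasible /=.
suff -> : \sum_(i < 2 * n) tnth y i *: antidiag_mx R n i.+1 + antidiag_mx R n 0
    = \matrix_(k < n.+1, l < n.+1) moment y (k + l) by [].
apply/matrixP => k l; rewrite !mxE summxE /moment.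
have : (k + l <= 2 * n)%N by rewrite mul2n -addnn leq_add // -ltnS.
move Ds: (k + l)%N => s; case: s Ds => [|s] Ds s2n /=.
  by rewrite big1 ?add0r // => i _; rewrite !mxE Ds mulr0.
rewrite addr0 (bigD1 (Ordinal s2n)) //= big1 => [|i /negbTE si].
  by rewrite !mxE Ds eqxx mulr1 addr0 (tnth_nth 0).
by rewrite !mxE Ds eqSS eq_sym -[s]/(val (Ordinal s2n)) val_eqE si mulr0.
Qed.

(* Main.v *)
Require Import Defs.
From mathcomp Require Import all_boot all_order all_algebra.
From mathcomp Require Import boolp reals exp.
From mathcomp Require Import ring lra.

Import Order.TTheory GRing.Theory Num.Theory.
Local Open Scope ring_scope.

(** Write [u k] for [y_(2k)].  The 2 x 2 principal minors of the Hankel matrix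
    on the rows [k] and [k + 2] say that the sequence [u] is nonnegative and
    log-convex, [u (k + 1) ^ 2 <= u k * u (k + 2)], and it starts at [u 0 = 1].
    Log-convexity of such a sequence makes [ln (u k) / k] nondecreasing; in a
    form without logarithms, which also covers vanishing terms, this is
    [u k ^ (k + 1) <= u (k + 1) ^ k] ([logconvex_expr_succ]).  Taking [k]-th
    roots gives the first family of inequalities, and chaining them from
    [u 1] up to [u n] gives the last one ([logconvex_expr_first]). *)

(** * Principal minors of a positive semidefinite matrix *)

Lemma psd_quad2 (R : realType) (p : nat) (S : 'M[R]_p) (i j : 'I_p) (s t : R) :
  psd S -> 0 <= s ^+ 2 * S i i + 2 * (s * t * S i j) + t ^+ 2 * S j j.
Proof.
case=> /eqP symS /(_ (s *: delta_mx i 0 + t *: delta_mx j 0)).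
have Sji : S j i = S i j by rewrite [in LHS]symS expr0 scale1r !mxE.
have dSd a b :
    ((delta_mx a 0 : 'cV_p)^T *m S *m (delta_mx b 0 : 'cV_p)) 0 0 = S a b.
  by rewrite -colE trmx_delta mxE -rowE mxE.
rewrite [(_ + _)^T]linearD !linearZ /= !mulmxDl !mulmxDr.
rewrite -!scalemxAl -!scalemxAr.
rewrite ![((_ : 'M_(1, 1)) + _) _ _]mxE ![(_ *: (_ : 'M_(1, 1))) _ _]mxE.
by rewrite !dSd Sji; congr (0 <= _); ring.
Qed.

Lemma psd_diag_ge0 (R : realType) (p : nat) (S : 'M[R]_p) (i : 'I_p) :
  psd S -> 0 <= S i i.
Proof. by move=> /(@psd_quad2 _ _ _ i i 1 0); lra. Qed.

Lemma psd_minor2 (R : realType) (p : nat) (S : 'M[R]_p) (i j : 'I_p) :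
  psd S -> S i j ^+ 2 <= S i i * S j j.
Proof.
move=> psdS; have Sii := psd_diag_ge0 _ _ _ i psdS.
have := psd_diag_ge0 _ _ _ j psdS; rewrite le_eqVlt => /orP[/eqP Sjj|Sjj].
  (* With S_jj = 0 the form is affine in t; these values of s and t give
     - S_ij^2 (S_ii + 2), which forces S_ij = 0. *)
  have := @psd_quad2 _ _ _ i j (S i j) (- (S i i + 1)) psdS.
  rewrite -Sjj !mulr0 addr0; set b := S i j; set a := S i i in Sii *.
  have := sqr_ge0 b; nra.
(* For s = 1 the form is minimal at t = - S_ij / S_jj; scaling this vector by
   S_jj turns the minimum into S_jj times the minor. *)
rewrite -subr_ge0 -(pmulr_rge0 _ Sjj).
have := @psd_quad2 _ _ _ i j (S j j) (- S i j) psdS.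
by congr (0 <= _); ring.
Qed.

(** * Log-convex sequences starting at 1 *)

(** Raising log-convexity to the power [k] and using the previous inequality
    on the factor [u (k - 1) ^ k] leaves a common factor [u k ^ (k - 1)], which
    cancels unless [u k = 0], in which case nothing is to be proved. *)
Lemma logconvex_expr_succ (R : realDomainType) (n : nat) (u : nat -> R) :
  u 0%N = 1 -> (forall k, (k <= n)%N -> 0 <= u k) ->
  (forall k, (k.+2 <= n)%N -> u k.+1 ^+ 2 <= u k * u k.+2) ->
  forall k, (k < n)%N -> u k ^+ k.+1 <= u k.+1 ^+ k.
Proof.
move=> u0 u_ge0 u_lc; elim=> [|k IHk] kn; first by rewrite u0.
have kn' := ltnW kn; have := u_ge0 _ kn'.
rewrite le_eqVlt => /orP[/eqP <-|uk_gt0].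
  by rewrite expr0n /= exprn_ge0 ?u_ge0.
rewrite -(ler_pM2l (exprn_gt0 k uk_gt0)) -exprD.
have -> : (k + k.+2 = 2 * k.+1)%N by rewrite mul2n -addnn addSnnS.
rewrite exprM (@le_trans _ _ ((u k * u k.+2) ^+ k.+1)) //.
  by apply: lerXn2r; rewrite ?nnegrE ?sqr_ge0 ?mulr_ge0 ?u_ge0 ?u_lc // ltnW.
by rewrite exprMn ler_wpM2r ?exprn_ge0 ?u_ge0 ?IHk.
Qed.

Lemma logconvex_expr_first (R : realDomainType) (n : nat) (u : nat -> R) :
  u 0%N = 1 -> (forall k, (k <= n)%N -> 0 <= u k) ->
  (forall k, (k.+2 <= n)%N -> u k.+1 ^+ 2 <= u k * u k.+2) ->
  forall k, (k <= n)%N -> u 1%N ^+ k <= u k.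
Proof.
move=> u0 u_ge0 u_lc; elim=> [|[|k] IHk] kn; rewrite ?u0 ?expr1 //.
have u1_ge0 : 0 <= u 1%N by rewrite u_ge0 // (leq_trans _ kn).
have kn' := ltnW kn.
rewrite -(@ler_pXn2r _ k.+1) ?nnegrE ?exprn_ge0 ?u1_ge0 ?u_ge0 //.
rewrite exprAC (le_trans _ (logconvex_expr_succ _ _ _ u0 u_ge0 u_lc _ kn)) //.
by apply: lerXn2r; rewrite ?nnegrE ?exprn_ge0 ?u1_ge0 ?u_ge0 ?IHk.
Qed.

Lemma powR_le_expr (R : realType) (x z : R) (k : nat) :
  (0 < k)%N -> 0 <= x -> 0 <= z -> x ^+ k.+1 <= z ^+ k ->
  x `^ (1 + 1 / k%:R) <= z.
Proof.
move=> k_gt0 x_ge0 z_ge0 xz; rewrite -(@ler_pXn2r _ k) ?nnegrE ?powR_ge0 //.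
have k_neq0 : k%:R != 0 :> R by rewrite pnatr_eq0 -lt0n.
rewrite -[X in X <= _]powR_mulrn ?powR_ge0 // -powRrM.
have -> : (1 + 1 / k%:R) * k%:R = k.+1%:R :> R by rewrite -natr1; field.
by rewrite powR_mulrn.
Qed.

(** * The moment inequalities *)

(** The even moments are the diagonal of the Hankel matrix, and the entry at
    [(k, k + 2)] is the even moment between the diagonal entries of its row
    and column. *)
Lemma hankel_even_logconvex (R : realType) (n : nat) (h : nat -> R) :
  psd (\matrix_(k < n.+1, l < n.+1) h (k + l)%N) ->
  (forall k, (k <= n)%N -> 0 <= h (2 * k)%N) /\
  (forall k, (k.+2 <= n)%N ->
     h (2 * k.+1)%N ^+ 2 <= h (2 * k)%N * h (2 * k.+2)%N).
Proof.
move=> psdH; split=> k kn.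
  have /psd_diag_ge0 := psdH; move/(_ (inord k)).
  by rewrite mxE inordK // addnn mul2n.
have /psd_minor2 := psdH; move/(_ (inord k) (inord k.+2)).
have kn' : (k < n.+1)%N by rewrite ltnS (leq_trans _ kn) // leqW.
by rewrite !mxE !inordK // !mul2n -!addnn [(k.+1 + _)%N]addSnnS.
Qed.

Theorem theorem2 (R : realType) (n : nat) (n_ge1 : (1 <= n)%N)
    (f : {poly R}) (size_f : size f = (2 * n).+1) (f_gt0 : 0 < f`_(2 * n))
    (y : (2 * n).-tuple R) (y_feas : sdp_feasible (dual_sos_sdp n f) y) :
  (forall j : nat, (1 <= j <= n - 1)%N ->
     moment y (2 * (n - j)) `^ (1 + 1 / (n - j)%:R)
       <= moment y (2 * (n - j + 1)))
  /\ moment y 2 ^+ n <= moment y (2 * n).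
Proof.
have /dual_sos_sdp_feasibleE/hankel_even_logconvex[u_ge0 u_lc] := y_feas.
pose u k := moment y (2 * k); have u0 : u 0%N = 1 by [].
split; last exact: (logconvex_expr_first _ n u).
move=> j /andP[j_ge1 j_le]; rewrite addn1.
have j_lt : (j < n)%N by rewrite -(subnK n_ge1) addn1 ltnS.
have k_lt : (n - j < n)%N by rewrite -subn_gt0 subKn // ltnW.
apply: powR_le_expr; rewrite ?subn_gt0 ?u_ge0 ?(ltnW k_lt) //.
exact: (logconvex_expr_succ _ n u).
Qed.
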